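(* For every integer $n\ge 0$, $$e_2p_4(n+48)\equiv e_2p_4(n)\pmod 2,$$ $$e_2p_4(n+54)\equiv e_2p_4(n)\pmod 3,$$ $$e_2p_4(n+96)\equiv e_2p_4(n)\pmod 4.$$
   Context: A partition $\lambda=(\lambda_1,\dots,\lambda_\ell)$ of $n$ is a weakly decreasing sequence of positive integers with sum $n$; its length is $\ell$. For a partition $\lambda$ of length $\ell$, $e_2(\lambda)=\sum_{1\le i<k\le \ell}\lambda_i\lambda_k$. $\mathcal P(4,n)$ denotes the set of partitions of $n$ of length exactly $4$, and $e_2p_4(n)=\sum_{\lambda\in\mathcal P(4,n)}e_2(\lambda)$ (an empty sum is $0$). *)

(* Defs.v *)
From mathcomp Require Import all_boot.

Set Implicit Arguments.
Unset Strict Implicit.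
Unset Printing Implicit Defensive.

Definition is_intpart (n : nat) (s : seq nat) : bool :=
  [&& sorted geq s, all (ltn 0) s & sumn s == n].

Definition e2 (s : seq nat) : nat :=
  \sum_(i < size s) \sum_(k < size s | i < k) nth 0 s i * nth 0 s k.

Definition parts (l n : nat) (t : l.-tuple 'I_n.+1) : seq nat :=
  [seq nat_of_ord i | i <- t].

(* Every part of a partition of n is at most n, so drawing the parts from
   'I_n.+1 loses nothing (intparts_complete) and makes the set finite. *)
Definition intparts (l n : nat) : {set l.-tuple 'I_n.+1} :=
  [set t | is_intpart n (parts t)].

Definition e2p (l n : nat) : nat := \sum_(t in intparts l n) e2 (parts t).

Lemma parts_inj (l n : nat) : injective (@parts l n).
Proof. by move=> t u /(inj_map val_inj) /val_inj. Qed.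

Lemma intparts_complete (l n : nat) (s : seq nat) :
  (is_intpart n s && (size s == l)) <->
  (exists2 t : l.-tuple 'I_n.+1, t \in intparts l n & parts t = s).
Proof.
split=> [/andP[ps /eqP sz]|[t]]; last first.
  by rewrite inE => pt <-; rewrite pt /parts size_map size_tuple /=.
have le_s : forall x, x \in s -> x < n.+1.
  case/and3P: ps => _ _ /eqP <- x; rewrite ltnS.
  elim: s {sz} => //= y s IHs; rewrite inE => /orP[/eqP ->|/IHs le_x].
    exact: leq_addr.
  exact: leq_trans le_x (leq_addl _ _).
have szt : size [seq inord x : 'I_n.+1 | x <- s] == l by rewrite size_map sz.
have eqs : parts (Tuple szt) = s.
  rewrite /parts /= -map_comp -[RHS]map_id; apply/eq_in_map=> x xs /=.
  by rewrite inordK // le_s.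
by exists (Tuple szt); rewrite ?inE ?eqs.
Qed.

(* Main.v *)
(** Let p_l(n) and E_l(n) be the number of partitions of n into at most l parts
    and the sum of e_2 over them. Either the l-th part is zero, or all l parts
    can be decreased by one, which changes e_2(mu) + (l-1)|mu| + C(l,2) into
    e_2(mu). Hence
      p_l(n+l) = p_{l-1}(n+l) + p_l(n),
      E_l(n+l) = E_{l-1}(n+l) + E_l(n) + ((l-1)n + C(l,2)) p_l(n).
    Modulo m, a function with f(n+k) = f(n) + h(n) and h of period T has period
    T as soon as f(n+T) = f(n) for n < k, so by induction on l the periodicity
    reduces to finitely many values, and e_2p_4 = E_4 - E_3. *)

Require Import Defs.
From mathcomp Require Import all_boot.
From mathcomp Require Import zify ring.

(** * Behaviour of [e2] under padding by zero and raising every part by one *)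

Lemma e2_cons x s : e2 (x :: s) = x * sumn s + e2 s.
Proof.
rewrite /e2 /= big_ord_recl; congr (_ + _).
  rewrite big_mkcond big_ord_recl /= add0n -big_distrr /=.
  by rewrite sumnE (big_nth 0) big_mkord.
apply: eq_bigr => i _; rewrite big_mkcond big_ord_recl /= add0n.
by rewrite [RHS]big_mkcond; apply: eq_bigr => k _.
Qed.

Lemma e2_nil : e2 [::] = 0.
Proof. by rewrite /e2 big_ord0. Qed.

Lemma e2_rcons0 s : e2 (rcons s 0) = e2 s.
Proof.
elim: s => [|x s IHs] /=; first by rewrite e2_cons muln0 e2_nil.
by rewrite !e2_cons IHs sumn_rcons addn0.
Qed.

Lemma sumn_mapS s : sumn (map succn s) = sumn s + size s.
Proof. by elim: s => //= x s ->; lia. Qed.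

(** Expand (x+1)(y+1) = xy + x + y + 1 over all pairs: each entry lies in [(size s).-1] pairs. *)
Lemma e2_mapS s :
  e2 (map succn s) = e2 s + ((size s).-1 * sumn s + 'C(size s, 2)).
Proof.
elim: s => [|x s IHs] /=; first by rewrite e2_nil.
rewrite !e2_cons IHs sumn_mapS binS bin1.
(* The truncated [(size s).-1] must be resolved before [ring] applies. *)
by case: s {IHs} => [|y s] /=; first lia; ring.
Qed.

(** * Zero-padded partitions, split by their last entry *)

(* Partitions of n into at most l parts, padded with zeros to length l. *)
Definition weak_parts (l n : nat) : seq (seq nat) :=
  [seq parts t | t in [set t : l.-tuple 'I_n.+1 |
                       sorted geq (parts t) && (sumn (parts t) == n)]].

Lemma mem_weak_parts l n s :
  (s \in weak_parts l n) = [&& size s == l, sorted geq s & sumn s == n].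
Proof.
apply/imageP/and3P => [[t + ->]|[sz st /eqP en]].
  by rewrite inE size_map size_tuple => /andP[].
have le_s x : x \in s -> x < n.+1.
  by move=> xs; rewrite ltnS -en (perm_sumn (perm_to_rem xs)) leq_addr.
have szt : size [seq inord x : 'I_n.+1 | x <- s] == l by rewrite size_map.
have eqs : parts (Tuple szt) = s.
  rewrite /parts /= -map_comp -[RHS]map_id; apply/eq_in_map=> x xs /=.
  by rewrite inordK // le_s.
by exists (Tuple szt); rewrite // inE eqs st en eqxx.
Qed.

Lemma weak_parts_uniq l n : uniq (weak_parts l n).
Proof. by rewrite map_inj_uniq ?enum_uniq //; apply: parts_inj. Qed.

Definition pos_parts (l n : nat) := [seq s <- weak_parts l n | all (ltn 0) s].


Lemma e2pE l n : e2p l n = \sum_(s <- pos_parts l n) e2 s.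
Proof.
rewrite big_filter big_map big_enum_cond /=; apply: eq_bigl => t.
by rewrite !inE /is_intpart [RHS]andbAC -andbA.
Qed.

Lemma sorted_geq_rcons s x :
  sorted geq (rcons s x) = all (geq^~ x) s && sorted geq s.
Proof.
have tr : transitive geq by move=> a b c /= ba ac; apply: leq_trans ac ba.
by rewrite !sorted_pairwise // pairwise_rcons.
Qed.

Lemma weak_partsS l n :
  perm_eq (weak_parts l.+1 n)
          ([seq rcons s 0 | s <- weak_parts l n] ++ pos_parts l.+1 n).
Proof.
have memr s : (rcons s 0 \in weak_parts l.+1 n) = (s \in weak_parts l n).
  rewrite !mem_weak_parts size_rcons eqSS sorted_geq_rcons sumn_rcons addn0.
  by rewrite all_predT.
apply: uniq_perm; first exact: weak_parts_uniq.
  rewrite cat_uniq map_inj_uniq ?weak_parts_uniq; last exact: rcons_injl.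
  rewrite filter_uniq ?weak_parts_uniq // andbT /=; apply/hasPn => s.
  rewrite mem_filter => /andP[s_gt0 _]; apply: contraL s_gt0 => /mapP[t _ ->].
  by rewrite all_rcons.
move=> s; rewrite mem_cat mem_filter.
case: (boolP (s \in weak_parts _ _)) => [s_in|sNin]; last first.
  rewrite andbF orbF; apply/esym/negP => /mapP[t t_in def_s].
  by rewrite def_s memr t_in in sNin.
rewrite andbT; case: (lastP s) s_in => [|t [|x]]; first by rewrite orbT.
  by rewrite memr => /(map_f (rcons^~ 0)) ->.
rewrite mem_weak_parts sorted_geq_rcons => /and3P[_ /andP[t_gt _] _].
apply/esym/orP; right; rewrite all_rcons /=.
by apply: sub_all t_gt => y /=; apply: leq_trans.
Qed.

Lemma pos_partsD l n :
  perm_eq (pos_parts l (n + l)) [seq map succn s | s <- weak_parts l n].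
Proof.
have injS : injective (map succn) by apply/inj_map/succn_inj.
have memS s : (map succn s \in weak_parts l (n + l)) = (s \in weak_parts l n).
  rewrite !mem_weak_parts size_map sumn_mapS sorted_map.
  by case: eqP => //= <-; rewrite eqn_add2r.
apply: uniq_perm.
- by rewrite filter_uniq ?weak_parts_uniq.
- by rewrite map_inj_uniq ?weak_parts_uniq.
move=> s; rewrite mem_filter; apply/andP/mapP => [[s_gt0 s_in]|[t t_in ->]].
  have def_s : s = map succn (map predn s).
    rewrite -map_comp -[LHS]map_id; apply/eq_in_map => x /(allP s_gt0) /=.
    by move/prednK.
  by exists (map predn s); rewrite // -memS -def_s.
by rewrite memS t_in all_map; split=> //; apply/allP.
Qed.

Lemma pos_parts_small l n : n < l -> pos_parts l n = [::].
Proof.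
move=> lt_nl; apply/eqP; rewrite -(negbK (_ == _)) -has_filter; apply/hasPn=> s.
rewrite mem_weak_parts => /and3P[/eqP sz _ /eqP en]; apply: contraL lt_nl.
rewrite -sz -en -leqNgt => {sz en}; elim: s => //= x s IHs /andP[x_gt0 /IHs].
by move=> le_s; rewrite -add1n leq_add.
Qed.

(** * Recurrences for the counts and for the sums of [e2] *)

Definition npart l n := size (weak_parts l n).
Definition e2weak l n := \sum_(s <- weak_parts l n) e2 s.

Lemma npart0 n : npart 0 n = (n == 0).
Proof.
have H s : (s \in weak_parts 0 n) = (s == [::]) && (n == 0).
  by rewrite mem_weak_parts; case: s => [|x s] //=; rewrite eq_sym.
(* The list has no duplicates and no member but [[::]], so its size is the count of [[::]]. *)
have := count_uniq_mem [::] (weak_parts_uniq 0 n); rewrite H eqxx /= => <-.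
apply/esym/eqP; rewrite -all_count; apply/allP => s.
by rewrite H /= eq_sym => /andP[].
Qed.

Lemma e2weak0 n : e2weak 0 n = 0.
Proof.
rewrite /e2weak big_seq big1 // => s; rewrite mem_weak_parts.
by case/andP => /nilP -> _; apply: e2_nil.
Qed.

Lemma npartS l n : npart l.+1 n = npart l n + size (pos_parts l.+1 n).
Proof. by rewrite /npart (perm_size (weak_partsS l n)) size_cat size_map. Qed.

Lemma e2weakS l n : e2weak l.+1 n = e2weak l n + e2p l.+1 n.
Proof.
rewrite e2pE /e2weak (perm_big _ (weak_partsS l n)) big_cat big_map /=.
by congr (_ + _); apply: eq_bigr => s _; apply: e2_rcons0.
Qed.

Lemma size_pos_partsD l n : size (pos_parts l (n + l)) = npart l n.
Proof. by rewrite (perm_size (pos_partsD l n)) size_map. Qed.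

Lemma e2pD l n :
  e2p l (n + l) = e2weak l n + (l.-1 * n + 'C(l, 2)) * npart l n.
Proof.
rewrite e2pE (perm_big _ (pos_partsD l n)) big_map /= /npart -sum1_size.
rewrite big_distrr -big_split !big_seq; apply: eq_bigr => s /=.
rewrite mem_weak_parts => /and3P[/eqP sz _ /eqP en].
by rewrite e2_mapS sz en muln1.
Qed.

Lemma npartD l n : npart l.+1 (n + l.+1) = npart l.+1 n + npart l (n + l.+1).
Proof. by rewrite npartS size_pos_partsD addnC. Qed.

Lemma e2p_small l n : n < l -> e2p l n = 0.
Proof. by move=> lt_nl; rewrite e2pE pos_parts_small // big_nil. Qed.

Lemma npart_small l n : n < l.+1 -> npart l.+1 n = npart l n.
Proof. by move=> lt_nl; rewrite npartS pos_parts_small ?addn0. Qed.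

Lemma e2weakD l n :
  e2weak l.+1 (n + l.+1) =
  e2weak l.+1 n + (e2weak l (n + l.+1) + (l * n + 'C(l.+1, 2)) * npart l.+1 n).
Proof. by rewrite e2weakS e2pD addnCA. Qed.

Lemma e2weak_small l n : n < l.+1 -> e2weak l.+1 n = e2weak l n.
Proof. by move=> lt_nl; rewrite e2weakS e2p_small ?addn0. Qed.

(** * Evaluation of the recurrences modulo m *)

Section Residues.

Variable m : nat.

(** An executable form of the two recurrences, reduced modulo [m] at each step so that [vm_compute]
    can check initial values without enumerating partitions. Fuel [n] suffices because each call
    lowers the argument by [l], which is positive. *)
Fixpoint residues (l n : nat) : nat * nat :=
  if l is l'.+1 then
    (fix rec fuel n :=
       let: (p, b) := residues l' n in
       if fuel is fuel'.+1 then
         if l <= n then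
           let: (q, c) := rec fuel' (n - l) in
           ((q + p) %% m, (c + (b + (l' * (n - l) + 'C(l, 2)) * q)) %% m)
         else (p, b)
       else (p, b)) n n
  else ((n == 0) %% m, 0).

Lemma residuesE l n : residues l n = (npart l n %% m, e2weak l n %% m).
Proof.
elim: l n => [|l IHl] n /=; first by rewrite npart0 e2weak0 mod0n.
(* Induction needs the fuel detached from [n]: any fuel at least [n] gives the same result. *)
have: n <= n by []; move: {2 3}n => fuel.
elim: fuel n => [|fuel IHfuel] n.
  rewrite leqn0 => /eqP ->.
  by rewrite IHl npart_small // e2weak_small.
move=> le_n; rewrite IHl; case: (ltnP l n) => [lt_ln|le_nl]; last first.
  by rewrite npart_small // e2weak_small.
rewrite -(subnK lt_ln) addnK in le_n *; move: (n - _) le_n => k le_k.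
rewrite IHfuel; last by lia.
rewrite npartD e2weakD modnDm; congr (_, _).
by rewrite modnDml addnCA modnDml addnCA !addnA -modnDmr modnMmr modnDmr.
Qed.

End Residues.

(** * Periodicity from finitely many values *)

Lemma periodic_rec (m T k : nat) (f h : nat -> nat) : 0 < k ->
    (forall n, f (n + k) = f n + h n) ->
    (forall n, h (n + T) = h n %[mod m]) ->
    (forall n, n < k -> f (n + T) = f n %[mod m]) ->
  forall n, f (n + T) = f n %[mod m].
Proof.
move=> k_gt0 fD hT fT; elim/ltn_ind=> n IHn.
case: (ltnP n k) => [/fT //|le_kn].
rewrite -(subnK le_kn) addnAC !fD -modnDm IHn ?hT ?modnDm //.
by rewrite ltn_subrL k_gt0 (leq_trans k_gt0).
Qed.

Section Periodicity.

Variables m T : nat.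
Hypothesis m_dvd_T : m %| T.

(** Periodicity is asked only of the product of [npart l.+1] with its coefficient, so that it can
    still hold where [npart l.+1] itself is not periodic. *)
Lemma e2weak_periodicS l :
    (forall n, e2weak l (n + T + l.+1) = e2weak l (n + l.+1) %[mod m]) ->
    (forall n, (l * n + 'C(l.+1, 2)) * npart l.+1 (n + T) =
               (l * n + 'C(l.+1, 2)) * npart l.+1 n %[mod m]) ->
    all (fun n => (residues m l.+1 (n + T)).2 == (residues m l.+1 n).2)
        (iota 0 l.+1) ->
  forall n, e2weak l.+1 (n + T) = e2weak l.+1 n %[mod m].
Proof.
move=> IHe IHp /allP base; apply: periodic_rec (e2weakD l) _ _ => // n.
  (* The linear coefficient has period [T] because [m] divides [T]. *)
  have lT : l * (n + T) + 'C(l.+1, 2) = l * n + 'C(l.+1, 2) %[mod m].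
    by rewrite mulnDr addnAC -modnDmr (eqP (dvdn_mull l m_dvd_T)) addn0.
  by rewrite -modnDm IHe -modnMml lT modnMml IHp modnDm.
move=> lt_nl; have := base n; rewrite mem_iota !residuesE => /(_ lt_nl).
by move/eqP.
Qed.

(* [0 < l + n] excludes p_0(0) = 1, the only non-periodic value of p_0. *)
Lemma weak_periodic L :
    all (fun l => all (fun n => residues m l (n + T) == residues m l n)
                      (iota 0 l)) (iota 1 L) ->
  forall l n, l <= L -> 0 < l + n ->
  npart l (n + T) = npart l n %[mod m] /\
  e2weak l (n + T) = e2weak l n %[mod m].
Proof.
move=> /allP base; elim=> [|l IHl] n le_lL.
  by rewrite !npart0 !e2weak0; case: n.
move=> _; have {}base k : k < l.+1 -> residues m l.+1 (k + T) = residues m l.+1 k.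
  have /base/allP base_l : l.+1 \in iota 1 L by rewrite mem_iota.
  by move=> lt_kl; apply/eqP/base_l; rewrite mem_iota.
have IH k : 0 < l + k -> _ := IHl k (ltnW le_lL).
have pT k : npart l.+1 (k + T) = npart l.+1 k %[mod m].
  apply: periodic_rec (npartD l) _ _ k => // k.
    (* The argument [k + l.+1] is positive, so the exceptional value of [npart 0] is never met. *)
    by rewrite addnAC; apply: (IH _ _).1; lia.
  by move/base; rewrite !residuesE => -[].
split; first exact: pT.
apply: e2weak_periodicS => [k|k|].
- by rewrite addnAC; apply: (IH _ _).2; lia.
- by rewrite -modnMmr pT modnMmr.
- by apply/allP => k; rewrite mem_iota => /base ->.
Qed.

Lemma e2p_periodic l :
    (forall n, e2weak l (n + T) = e2weak l n %[mod m]) ->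
    (forall n, e2weak l.+1 (n + T) = e2weak l.+1 n %[mod m]) ->
  forall n, e2p l.+1 (n + T) = e2p l.+1 n %[mod m].
Proof.
move=> eT eST n; apply/eqP.
(* Adding [e2weak l n] to both sides replaces the subtraction of E_l from E_(l+1). *)
rewrite -(eqn_modDl (e2weak l n)) -e2weakS -eST e2weakS eqn_modDr.
by rewrite eT.
Qed.

End Periodicity.

Theorem theorem2 (n : nat) :
  [/\ e2p 4 (n + 48) = e2p 4 n %[mod 2],
      e2p 4 (n + 54) = e2p 4 n %[mod 3]
    & e2p 4 (n + 96) = e2p 4 n %[mod 4]].
Proof.
split.
(* The computation compares the residues at [n] and [n + 48] for all [n < l] with l from 1 to 4. *)
- have P := @weak_periodic 2 48 isT 4 ltac:(by vm_compute).
  by apply: e2p_periodic => k; [case: (P 3 k) | case: (P 4 k)].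
(* Counts and sums are treated jointly only up to length 3; [e2weak 4] follows from its own
   recurrence. *)
- have P := @weak_periodic 3 54 isT 3 ltac:(by vm_compute).
  apply: e2p_periodic => k; first by case: (P 3 k).
  apply: e2weak_periodicS => [|j|j|]; [by [] | | | by vm_compute].
    by rewrite addnAC; case: (P 3 (j + 4)).
  (* p_4 does not have period 54 mod 3, but its coefficient 3j + 6 vanishes. *)
  have -> : 3 * j + 'C(4, 2) = (j + 2) * 3 by rewrite mulnDl mulnC.
  by rewrite -!(mulnAC _ _ 3) !modnMl.
- have P := @weak_periodic 4 96 isT 4 ltac:(by vm_compute).
  by apply: e2p_periodic => k; [case: (P 3 k) | case: (P 4 k)].
Qed.
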